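(* Let $\varepsilon \in (0,1)$, and let $X \subset \mathbb{R}^d$ be a set of $n$ non-negative $s$-sparse vectors, fixed independently of the randomness below. Let $F: \mathbb{R}^d \rightarrow \mathbb{R}^{mT}$ be a non-negative $(d,m,T)$ embedding. (1) There are absolute constants such that if $m = O(s/\varepsilon)$ and $T = O(\log(ns)/\varepsilon)$ (with these constants), then with probability at least $1 - 1/\mathrm{poly}(n)$, for all $p \ge 1$ and all $x,y \in X$, \[ (1-\varepsilon)\|x-y\|_p^p \le \frac{\|F(x) - F(y)\|_p^p}{T} \le (1+\varepsilon)\|x-y\|_p^p. \] (2) There are absolute constants such that if $m = O(s)$ and $T = O(\log n)$ (with these constants), then \[\Pr\left( \forall x, y \in X,\ \|F(x) - F(y)\|_{\infty} = \|x-y\|_{\infty} \right) \ge 1 - 1/\mathrm{poly}(n).\] (3) If $m = 1$ and $T = 1$, then with probability $1$, for all $x,y \in X$, \[ \|x+y\|_{\infty} \le \|F(x) + F(y)\|_{\infty} \le 2\|x+y\|_{\infty}. \]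
   Context: The base mapping $f: \mathbb{R}^d \rightarrow \mathbb{R}^m$ is random and defined as follows. Pick a uniformly random function $h: [d] \rightarrow [m]$; for $i \in [m]$ let $S_i = \{ j \in [d] \mid h(j) = i\}$; for $x \in \mathbb{R}^d$ set $f(x)_i = \max\{ x_j \mid j \in S_i\}$ if $S_i \neq \emptyset$ and $f(x)_i = 0$ otherwise. A non-negative $(d,m,T)$ embedding $F: \mathbb{R}^d \rightarrow \mathbb{R}^{mT}$ is $F(x) = f_1(x) \oplus \cdots \oplus f_T(x)$ (concatenation), where $f_1,\dots,f_T$ are independent copies of the base mapping. A vector is $s$-sparse if it has at most $s$ non-zero coordinates. ''With probability at least $1-1/\mathrm{poly}(n)$'' means with probability at least $1-n^{-c}$ for some constant $c>0$ (which can be made larger by increasing the constants in $m,T$). *)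

(* Defs.v *)
From HB Require Import structures.
From mathcomp Require Import all_boot all_order all_algebra finmap.
From mathcomp Require Import boolp reals normedtype exp.

Set Implicit Arguments.
Unset Strict Implicit.
Unset Printing Implicit Defensive.
Import Order.TTheory GRing.Theory Num.Theory.
Local Open Scope ring_scope.

Section Embedding.
Context {R : realType}.

Definition nonneg_vec d (x : 'rV[R]_d) : Prop := forall j, 0 <= x 0 j.

Definition sparse d (s : nat) (x : 'rV[R]_d) : Prop :=
  (#|[pred j | (x 0 j != 0)%R]| <= s)%N.

(* The maximum norm is not redefined: it is the library norm `|v| on 'rV[R]_d,
   see mx_normrE. *)
Definition lpnorm d (p : R) (v : 'rV[R]_d) : R :=
  (\sum_(j < d) `|v 0 j| `^ p) `^ p^-1.

Definition bucket d m (h : {ffun 'I_d -> 'I_m}) (i : 'I_m) : {set 'I_d} :=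
  [set j | h j == i]%SET.

(* The iterated maximum starts from a coordinate of the bucket, so that it is
   the true maximum over the bucket also when all these coordinates are
   negative. *)
Definition base_map d m (h : {ffun 'I_d -> 'I_m}) (x : 'rV[R]_d) : 'rV[R]_m :=
  \row_(i < m)
    if [pick j in bucket h i] is Some j0
    then \big[Order.max/x 0 j0]_(j in bucket h i) x 0 j
    else 0.

(* The outcomes of the random choice: one hash function for each of the T
   copies of the base mapping. *)
Definition hashes d m T := {ffun 'I_T -> {ffun 'I_d -> 'I_m}}.

(* mxvec concatenates the rows of a matrix. *)
Definition embed d m T (H : hashes d m T) (x : 'rV[R]_d) : 'rV[R]_(T * m) :=
  mxvec (\matrix_(t < T) base_map (H t) x).

Definition unif (A : finType) (a : A) : R := #|A|%:R^-1.

(* Independence of the T uniform hash functions: the law of the tuple is the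
   product of the uniform laws. *)
Definition Pr d m T (E : hashes d m T -> Prop) : R :=
  \sum_(H : hashes d m T | `[< E H >]) \prod_(t < T) unif (H t).

Definition sparse_family d (n s : nat) (X : {fset 'rV[R]_d}) : Prop :=
  #|` X| = n /\ forall x, x \in X -> nonneg_vec x /\ sparse s x.

End Embedding.

(* Main.v *)
Require Import Defs.
From HB Require Import structures.
From mathcomp Require Import all_boot all_order all_algebra finmap.
From mathcomp Require Import ring lra.
From mathcomp Require Import boolp reals sequences normedtype exp.

Set Implicit Arguments.
Unset Strict Implicit.
Unset Printing Implicit Defensive.
Import Order.TTheory GRing.Theory Num.Theory.
Local Open Scope ring_scope.

(* Since [max] is 1-Lipschitz, one copy of the base mapping never increases an
   l_p or l_oo distance, so both upper bounds hold surely. Conversely, let [S]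
   be the union of the supports of [x] and [y]. If the hash of a copy sends no
   other element of [S] to the bucket of [j], the difference [x j - y j] is an
   output coordinate of that copy. A given [j] fails in a given copy with
   probability at most [2 s / m], so a Chernoff bound over the [T] copies and a
   union bound over the triples [(x, y, j)] leave every [j] failing in fewer
   than [eps T] copies, which gives (1). For (2) one non-failing copy, i.e.
   [eps = 1], suffices, for a single [j] attaining [`|x - y|]; hence no factor
   [s] in the union bound. In (3) the map is the maximum norm itself. *)

(** * Bounds that hold for a given outcome of the hashes *)

Section Deterministic.
Context {R : realType}.
Implicit Types (d m T : nat) (p : R).

Lemma rV_norm_ge_coord d (v : 'rV[R]_d) j : `|v 0 j| <= `|v|.
Proof.
rewrite [leRHS]mx_normrE.
exact: (le_bigmax_cond 0 (fun ij : 'I_1 * 'I_d => `|v ij.1 ij.2|)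
  (j := (0, j)) isT).
Qed.

Lemma rV_norm_le d (v : 'rV[R]_d) (a : R) :
  0 <= a -> (forall j, `|v 0 j| <= a) -> `|v| <= a.
Proof.
move=> a0 va; rewrite [leLHS]mx_normrE; apply: bigmax_le => // -[i j] _ /=.
by rewrite (ord1 i).
Qed.

Lemma rV_norm_attained d (v : 'rV[R]_d) :
  v != 0 -> exists j, `|v| = `|v 0 j|.
Proof.
move=> v0; have /mx_norm_neq0[[i j] /= e] : mx_norm v != 0.
  by apply: contra_neq v0 => /mx_norm_eq0.
by exists j; rewrite -(ord1 i).
Qed.

Lemma lpnorm_powR d p (v : 'rV[R]_d) : p != 0 ->
  lpnorm p v `^ p = \sum_j `|v 0 j| `^ p.
Proof.
move=> p0; rewrite /lpnorm -powRrM mulVf// powRr1//.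
by apply: sumr_ge0 => j _; exact: powR_ge0.
Qed.

(** One half of the Lipschitz bound for the maximum; exchanging [a] and [b] gives the other half. *)
Lemma big_max_le_add (I : finType) (P : pred I) (a b : I -> R) :
  \big[Num.max/0]_(i | P i) a i <=
  \big[Num.max/0]_(i | P i) b i + \big[Num.max/0]_(i | P i) `|a i - b i|.
Proof.
have ge0 (c : I -> R) : 0 <= \big[Num.max/0]_(i | P i) c i.
  exact: bigmax_ge_id.
apply: bigmax_le => [|i Pi]; first exact: addr_ge0.
rewrite -lerBlDl; apply: le_trans (le_bigmax_cond _ _ Pi).
by apply: le_trans (ler_norm _); rewrite lerD2l lerN2 le_bigmax_cond.
Qed.

Lemma big_max_dist (I : finType) (P : pred I) (a b : I -> R) :
  `|\big[Num.max/0]_(i | P i) a i - \big[Num.max/0]_(i | P i) b i| <=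
  \big[Num.max/0]_(i | P i) `|a i - b i|.
Proof.
rewrite ler_norml lerBlDl big_max_le_add andbT lerNl opprB lerBlDl.
under [X in _ <= _ + X]eq_bigr do rewrite distrC.
exact: big_max_le_add.
Qed.

(** The maximum is one of the [a i] or the floor 0, and the power of 0 is 0 because [p != 0]. *)
Lemma big_max_powR_le_sum (I : finType) (P : pred I) (a : I -> R) p :
  p != 0 -> (forall i, 0 <= a i) ->
  (\big[Num.max/0]_(i | P i) a i) `^ p <= \sum_(i | P i) a i `^ p.
Proof.
move=> p0 a0.
elim/big_rec2: _ => [|i s M _ Ms]; first by rewrite powR0.
have s0 : 0 <= s by apply: le_trans Ms; exact: powR_ge0.
case: (leP (a i) M) => _; last by rewrite lerDl.
by apply: le_trans Ms _; rewrite lerDr powR_ge0.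
Qed.

(** For non-negative vectors 0 is a harmless start of the maximum, and it also gives the right value
    on an empty bucket. *)
Lemma base_mapE d m (h : {ffun 'I_d -> 'I_m}) (x : 'rV[R]_d) i :
  nonneg_vec x ->
  base_map h x 0 i = \big[Num.max/0]_(j in bucket h i) x 0 j.
Proof.
move=> x0; rewrite mxE; case: pickP => [j0 j0h|none]; last by rewrite big_pred0.
apply/le_anti/andP; split; apply: bigmax_le.
- exact: le_bigmax_cond.
- by move=> j jh; exact: le_bigmax_cond.
- exact: le_trans (x0 j0) (bigmax_ge_id _ _ _ _).
- by move=> j jh; exact: le_bigmax_cond.
Qed.

Lemma base_map_dist d m (h : {ffun 'I_d -> 'I_m}) (x y : 'rV[R]_d) i :
  nonneg_vec x -> nonneg_vec y ->
  `|base_map h x 0 i - base_map h y 0 i| <=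
  \big[Num.max/0]_(j in bucket h i) `|x 0 j - y 0 j|.
Proof. by move=> x0 y0; rewrite !base_mapE//; exact: big_max_dist. Qed.

(** Coordinates outside [S] may share the bucket of [j]: the vectors considered vanish there, and a
    0 does not affect a maximum of non-negative numbers. *)
Definition isolated d m (h : {ffun 'I_d -> 'I_m}) (S : {set 'I_d}) (j : 'I_d)
    : bool :=
  [forall k in S, (k != j) ==> (h k != h j)].

Lemma isolatedP d m (h : {ffun 'I_d -> 'I_m}) (S : {set 'I_d}) j k :
  isolated h S j -> k \in S -> h k = h j -> k = j.
Proof.
move=> /forall_inP/(_ k) iso kS hkj; apply/eqP.
by apply: contraT => /(implyP (iso kS)); rewrite hkj eqxx.
Qed.

Lemma base_map_isolated d m (h : {ffun 'I_d -> 'I_m}) (S : {set 'I_d}) j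
    (x : 'rV[R]_d) :
  nonneg_vec x -> (forall k, k \notin S -> x 0 k = 0) -> isolated h S j ->
  base_map h x 0 (h j) = x 0 j.
Proof.
move=> x0 xS iso; rewrite base_mapE//; apply/le_anti/andP; split.
  apply: bigmax_le => // k; rewrite inE => /eqP hkj.
  have [kS|kS] := boolP (k \in S); first by rewrite (isolatedP iso kS hkj).
  by rewrite xS.
by apply: le_bigmax_cond; rewrite inE.
Qed.

(** * From one base map to the concatenation of the copies *)

Lemma embed_mxvec_index d m T (H : hashes d m T) (x : 'rV[R]_d) t i :
  embed H x 0 (mxvec_index t i) = base_map (H t) x 0 i.
Proof. by rewrite mxvecE mxE. Qed.

Lemma sum_embed d m T (H : hashes d m T) (x y : 'rV[R]_d) (f : R -> R) :
  \sum_k f ((embed H x - embed H y) 0 k) =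
  \sum_t \sum_i f (base_map (H t) x 0 i - base_map (H t) y 0 i).
Proof.
rewrite (reindex _ (curry_mxvec_bij T m)) pair_bigA/=.
by apply: eq_bigr => -[t i] _ /=; rewrite !mxE/= !mxvecE !mxE.
Qed.

(** The buckets partition the coordinates, and the power of a maximum over a bucket is at most the
    sum of the powers over it. *)
Lemma base_map_lp_le d m (h : {ffun 'I_d -> 'I_m}) (x y : 'rV[R]_d) p :
  0 < p -> nonneg_vec x -> nonneg_vec y ->
  \sum_i `|base_map h x 0 i - base_map h y 0 i| `^ p <=
  \sum_j `|x 0 j - y 0 j| `^ p.
Proof.
move=> p0 x0 y0; rewrite [leRHS](partition_big h xpredT)//=.
apply: ler_sum => i _.
rewrite (eq_bigl (fun j => j \in bucket h i)); last by move=> j; rewrite inE.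
apply: le_trans (big_max_powR_le_sum (mem (bucket h i))
  (a := fun j => `|x 0 j - y 0 j|) (lt0r_neq0 p0) _) => //.
apply: (ge0_ler_powR (ltW p0)); rewrite ?nnegrE ?bigmax_ge_id//.
exact: base_map_dist.
Qed.

Lemma embed_lp_le d m T (H : hashes d m T) (x y : 'rV[R]_d) p :
  0 < p -> nonneg_vec x -> nonneg_vec y ->
  lpnorm p (embed H x - embed H y) `^ p <= T%:R * lpnorm p (x - y) `^ p.
Proof.
move=> p0 x0 y0; rewrite !lpnorm_powR ?lt0r_neq0//.
rewrite (sum_embed H x y (fun a => `|a| `^ p)) mulr_natl -[in leRHS](card_ord T).
rewrite -sumr_const; apply: ler_sum => t _.
apply: le_trans (base_map_lp_le (H t) p0 x0 y0) _.
by apply: ler_sum => j _; rewrite !mxE.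
Qed.

(** [h] is injective on the isolated elements of [S], so their differences appear at distinct output
    coordinates. *)
Lemma base_map_lp_ge d m (h : {ffun 'I_d -> 'I_m}) (S : {set 'I_d})
    (x y : 'rV[R]_d) p :
  nonneg_vec x -> nonneg_vec y ->
  (forall k, k \notin S -> x 0 k = 0) -> (forall k, k \notin S -> y 0 k = 0) ->
  \sum_(j in S | isolated h S j) `|x 0 j - y 0 j| `^ p <=
  \sum_i `|base_map h x 0 i - base_map h y 0 i| `^ p.
Proof.
move=> x0 y0 xS yS; pose A := [set j in S | isolated h S j].
pose g i := `|base_map h x 0 i - base_map h y 0 i| `^ p.
have -> : \sum_(j in S | isolated h S j) `|x 0 j - y 0 j| `^ p =
    \sum_(j in A) g (h j).
  apply: eq_big => [j|j /andP[_ iso]]; first by rewrite inE.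
  by rewrite /g !(base_map_isolated _ _ iso).
rewrite -(big_imset g (h := h)); last first.
  move=> j k; rewrite !inE => /andP[jS _] /andP[_ kI].
  exact: (isolatedP kI).
rewrite [leRHS](bigID (mem (h @: A)))/= lerDl.
by apply: sumr_ge0 => i _; exact: powR_ge0.
Qed.

Definition collisions d m T (H : hashes d m T) (S : {set 'I_d}) (j : 'I_d)
    : nat :=
  #|[set t | ~~ isolated (H t) S j]|.

(** After exchanging the sums over copies and coordinates, each [j] in [S] counts once per copy
    isolating it, so at least [(1 - eps) * T] times. *)
Lemma embed_lp_ge d m T (H : hashes d m T) (S : {set 'I_d}) (x y : 'rV[R]_d)
    p (eps : R) :
  p != 0 -> nonneg_vec x -> nonneg_vec y ->
  (forall k, k \notin S -> x 0 k = 0) -> (forall k, k \notin S -> y 0 k = 0) ->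
  (forall j, j \in S -> (collisions H S j)%:R <= eps * T%:R) ->
  (1 - eps) * T%:R * lpnorm p (x - y) `^ p <=
  lpnorm p (embed H x - embed H y) `^ p.
Proof.
move=> p0 x0 y0 xS yS few; rewrite !lpnorm_powR//.
rewrite (sum_embed H x y (fun a => `|a| `^ p)).
apply: (@le_trans _ _
  (\sum_t \sum_(j in S | isolated (H t) S j) `|x 0 j - y 0 j| `^ p)); last first.
  by apply: ler_sum => t _; exact: base_map_lp_ge.
under [leRHS]eq_bigr do rewrite big_mkcondr.
rewrite exchange_big/= mulr_sumr (bigID (mem S))/= [X in _ + X]big1 ?addr0.
  apply: ler_sum => j jS; rewrite -big_mkcond/= sumr_const -[leRHS]mulr_natl !mxE.
  apply: ler_wpM2r; first exact: powR_ge0.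
  suff: (1 - eps) * T%:R <= #|[pred t | isolated (H t) S j]|%:R by [].
  have /(congr1 (fun k => k%:R : R)) :
      (collisions H S j + #|[pred t | isolated (H t) S j]| = T)%N.
    rewrite -[RHS](card_ord T) -(cardsC [set t | ~~ isolated (H t) S j]).
    by congr addn; apply: eq_card => t; rewrite !inE negbK.
  by rewrite natrD; move: (few _ jS); lra.
by move=> j jS; rewrite !mxE xS// yS// subrr normr0 powR0 ?mulr0.
Qed.

Lemma embed_sup_le d m T (H : hashes d m T) (x y : 'rV[R]_d) :
  nonneg_vec x -> nonneg_vec y -> `|embed H x - embed H y| <= `|x - y|.
Proof.
move=> x0 y0; apply: rV_norm_le => // k; case/mxvec_indexP: k => t i.
rewrite mxE [X in _ + X]mxE !embed_mxvec_index.
apply: le_trans (base_map_dist _ _ x0 y0) _; apply: bigmax_le => // j _.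
by apply: le_trans (rV_norm_ge_coord _ j); rewrite !mxE.
Qed.

Lemma embed_sup_ge d m T (H : hashes d m T) (S : {set 'I_d}) (x y : 'rV[R]_d)
    t j :
  nonneg_vec x -> nonneg_vec y ->
  (forall k, k \notin S -> x 0 k = 0) -> (forall k, k \notin S -> y 0 k = 0) ->
  isolated (H t) S j ->
  `|(x - y) 0 j| <= `|embed H x - embed H y|.
Proof.
move=> x0 y0 xS yS iso.
apply: le_trans (rV_norm_ge_coord _ (mxvec_index t (H t j))).
rewrite !mxE !mxvecE !mxE.
have := base_map_isolated x0 xS iso; have := base_map_isolated y0 yS iso.
by rewrite !mxE => -> ->.
Qed.

Lemma embed1 d (H : hashes d 1 1) (x : 'rV[R]_d) k :
  nonneg_vec x -> embed H x 0 k = `|x|.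
Proof.
move=> x0; case/mxvec_indexP: k => t i; rewrite embed_mxvec_index base_mapE//.
apply/le_anti/andP; split.
  by apply: bigmax_le => // j _; apply: le_trans (rV_norm_ge_coord _ j);
    exact: ler_norm.
apply: rV_norm_le => [|j]; first exact: bigmax_ge_id.
rewrite ger0_norm//; apply: le_bigmax_cond.
by rewrite inE (ord1 (H t j)) (ord1 i).
Qed.

Lemma nonneg_norm_le_add d (x y : 'rV[R]_d) :
  nonneg_vec x -> nonneg_vec y -> `|x| <= `|x + y|.
Proof.
move=> x0 y0; apply: rV_norm_le => // j.
apply: le_trans (rV_norm_ge_coord _ j).
by rewrite mxE !ger0_norm ?addr_ge0// lerDl.
Qed.

(** The only output coordinate is [|x| + |y|]. The lower bound is then the triangle inequality; the
    upper one holds because adding a non-negative vector to another cannot lower the norm. *)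
Lemma embed1_sup d (H : hashes d 1 1) (x y : 'rV[R]_d) :
  nonneg_vec x -> nonneg_vec y ->
  `|x + y| <= `|embed H x + embed H y| <= 2 * `|x + y|.
Proof.
move=> x0 y0.
have E k : (embed H x + embed H y) 0 k = `|x| + `|y| by rewrite mxE !embed1.
apply/andP; split.
  apply: le_trans (ler_normD x y) _; rewrite -(E (mxvec_index 0 0)).
  exact: le_trans (ler_norm _) (rV_norm_ge_coord _ _).
apply: rV_norm_le => [|k]; first by rewrite mulr_ge0.
rewrite E ger0_norm ?addr_ge0// mulr_natl mulr2n lerD ?nonneg_norm_le_add//.
by rewrite addrC nonneg_norm_le_add.
Qed.

End Deterministic.

(** * Product measure on tuples of hashes, and tail bound for collisions *)

Section Probability.
Context {R : realType}.
Implicit Types (d m T : nat).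

Local Notation prob H := (\prod_t (unif (H t) : R)).

Lemma card_hash_gt0 d m : (0 < m)%N -> (0 < #|{ffun 'I_d -> 'I_m}|)%N.
Proof. by move=> m0; rewrite card_ffun !card_ord expn_gt0 m0. Qed.

Lemma prob_ge0 d m T (H : hashes d m T) : 0 <= prob H.
Proof. by apply: prodr_ge0 => t _; rewrite invr_ge0. Qed.

(** By distributivity the sum over tuples is the product of the total masses of [T] uniform laws. *)
Lemma sum_prob d m T : (0 < m)%N -> \sum_(H : hashes d m T) prob H = 1.
Proof.
move=> m0; rewrite -(bigA_distr_bigA (fun t h => unif h : R)) big1// => t _.
rewrite /unif sumr_const -[LHS]mulr_natl divff// pnatr_eq0 -lt0n.
exact: card_hash_gt0.
Qed.

Lemma Pr_ge0 d m T (E : hashes d m T -> Prop) : 0 <= Pr E :> R.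
Proof. by apply: sumr_ge0 => H _; exact: prob_ge0. Qed.

Lemma Pr_sure d m T (E : hashes d m T -> Prop) :
  (0 < m)%N -> (forall H, E H) -> Pr E = 1 :> R.
Proof.
move=> m0 sure; rewrite -(sum_prob d T m0) /Pr.
by apply: eq_bigl => H; exact/asboolP.
Qed.

(** Holds outcome by outcome: an [H] outside [E] lies in some bad event, whose term already carries
    the weight of [H]. *)
Lemma Pr_union_bound (I : eqType) (r : seq I) d m T
    (B : I -> hashes d m T -> bool) (E : hashes d m T -> Prop) :
  (0 < m)%N -> (forall H, (forall i, i \in r -> ~~ B i H) -> E H) ->
  1 - \sum_(i <- r) Pr (B i) <= Pr E :> R.
Proof.
move=> m0 goodE; rewrite lerBlDr -(sum_prob d T m0) /Pr.
under [X in _ <= _ + X]eq_bigr do rewrite big_mkcond/=.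
rewrite exchange_big/= [X in _ <= X + _]big_mkcond -big_split/=.
apply: ler_sum => H _.
have ge0 s : 0 <= \sum_(i <- s) (if `[< B i H >] then prob H else 0).
  by apply: sumr_ge0 => i _; case: ifP => // _; exact: prob_ge0.
case: asboolP => [_|nE]; first by rewrite lerDl.
have [/hasP[i ir Bi]|/hasPn good] := boolP (has (B ^~ H) r); last first.
  by case: nE; exact: goodE.
rewrite add0r (perm_big _ (perm_to_rem ir)) big_cons/=.
by rewrite (asboolT Bi) lerDl.
Qed.

(* Recolouring [k] arbitrarily in a hash colliding at [j] and [k] loses no
   information. *)
Lemma card_collision d m (j k : 'I_d) : k != j ->
  (#|[set h : {ffun 'I_d -> 'I_m} | h k == h j]| * m <=
   #|{ffun 'I_d -> 'I_m}|)%N.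
Proof.
move=> kj; rewrite -[X in (_ * X)%N](card_ord m) -cardsT -cardsX.
pose recolour (hv : {ffun 'I_d -> 'I_m} * 'I_m) : {ffun 'I_d -> 'I_m} :=
  [ffun i => if i == k then hv.2 else hv.1 i].
apply: (@leq_card_in _ _ recolour) => -[h v] [h' v'].
rewrite !inE !andbT /= => /eqP hkj /eqP h'kj /ffunP e.
have off i : i != k -> h i = h' i.
  by move=> /negPf ik; have := e i; rewrite !ffunE ik.
congr pair; last by have := e k; rewrite !ffunE eqxx.
apply/ffunP => i; have [->|/off//] := eqVneq i k.
by rewrite hkj h'kj off// eq_sym.
Qed.

(** Union bound over the other elements of [S], each colliding with [j] in at most a fraction
    [1 / m] of the hashes. *)
Lemma card_not_isolated d m (S : {set 'I_d}) (j : 'I_d) :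
  (#|[set h : {ffun 'I_d -> 'I_m} | ~~ isolated h S j]| * m <=
   #|S| * #|{ffun 'I_d -> 'I_m}|)%N.
Proof.
apply: (@leq_trans ((\sum_(k in S | k != j)
    #|[set h : {ffun 'I_d -> 'I_m} | h k == h j]|) * m)).
  rewrite leq_mul2r; apply/orP; right.
  apply: (@leq_trans #|\bigcup_(k in S | k != j)
    [set h : {ffun 'I_d -> 'I_m} | h k == h j]|);
    last first.
    elim/big_rec2: _ => [|k N A _ AN]; first by rewrite cards0.
    by apply: leq_trans (leq_card_setU _ _).1 _; rewrite leq_add2l.
  apply: subset_leq_card; apply/subsetP => h; rewrite inE.
  rewrite negb_forall_in => /exists_inP[k kS].
  rewrite negb_imply negbK => /andP[kj hkj].
  by apply/bigcupP; exists k; rewrite ?kS// inE.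
rewrite big_distrl/= -sum_nat_const big_mkcondr/=.
apply: leq_sum => k kS; case: ifP => // kj; exact: card_collision.
Qed.

(* Exponential moment method: each collision is weighted by [expR 2], so that
   a copy contributes at most [1 + expR 2 * #|S| / m <= expR eps] to the
   moment, while the event has weight at least [expR (2 * eps * T)]. *)
Lemma Pr_collisions d m T (S : {set 'I_d}) (j : 'I_d) (eps : R) :
  (0 < m)%N -> expR 2 * #|S|%:R <= eps * m%:R ->
  Pr (fun H : hashes d m T => eps * T%:R <= (collisions H S j)%:R)
    <= expR (- (eps * T%:R)).
Proof.
move=> m0 Sm.
pose w (h : {ffun 'I_d -> 'I_m}) : R := if isolated h S j then 1 else expR 2.
have w_ge0 h : 0 <= w h by rewrite /w; case: ifP => // _; exact: expR_ge0.
have wE (H : hashes d m T) :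
    \prod_t w (H t) = expR (2 * (collisions H S j)%:R).
  rewrite /w mulrC expRM_natl /collisions -prodr_const [RHS]big_mkcond/=.
  by apply: eq_bigr => t _; rewrite inE; case: isolated.
have moment : \sum_(h : {ffun 'I_d -> 'I_m}) unif h * w h <= expR eps.
  rewrite /unif -mulr_sumr.
  have N0 := card_hash_gt0 d m0; set N := #|_| in N0 *.
  rewrite ler_pdivrMl ?ltr0n//.
  set B := #|[set h : {ffun 'I_d -> 'I_m} | ~~ isolated h S j]|.
  have -> : \sum_h w h = N%:R + (expR 2 - 1) * B%:R.
    have -> : N%:R = \sum_(h : {ffun 'I_d -> 'I_m}) 1 :> R by rewrite sumr_const.
    rewrite mulr_natr -sumr_const [X in _ + X]big_mkcond -big_split/=.
    apply: eq_bigr => h _; rewrite inE /w; case: isolated => /=.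
      by rewrite addr0.
    by rewrite addrC subrK.
  have Bm : B%:R * m%:R <= #|S|%:R * N%:R :> R.
    by rewrite -!natrM ler_nat card_not_isolated.
  have m0' : (0 : R) < m%:R by rewrite ltr0n.
  have BN : expR 2 * B%:R <= eps * N%:R.
    rewrite -(ler_pM2r m0') -mulrA.
    apply: (@le_trans _ _ (expR 2 * (#|S|%:R * N%:R))).
      by rewrite ler_pM2l ?expR_gt0.
    by rewrite mulrA [leRHS]mulrAC ler_wpM2r.
  apply: (@le_trans _ _ (N%:R * (1 + eps))); last first.
    by rewrite ler_wpM2l// expR_ge1Dx.
  by have : 0 <= B%:R :> R by []; lra.
(* Markov's inequality, with the threshold weight multiplied out. *)
rewrite -(ler_pM2l (expR_gt0 (2 * (eps * T%:R)))) -expRD.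
have -> : 2 * (eps * T%:R) - eps * T%:R = T%:R * eps by lra.
apply: (@le_trans _ _ (\sum_(H : hashes d m T) \prod_t (unif (H t) * w (H t)))).
  rewrite mulr_sumr big_mkcond/=; apply: ler_sum => H _.
  rewrite big_split/= wE; case: asboolP => [many|_].
    by rewrite mulrC ler_wpM2l ?prob_ge0// ler_expR ler_pM2l.
  by rewrite mulr_ge0 ?prob_ge0 ?expR_ge0.
(* Independence: the moment of the tuple is the [T]-th power of the moment of one copy. *)
rewrite -(bigA_distr_bigA (fun _ h => unif h * w h)) prodr_const card_ord.
rewrite expRM_natl lerXn2r ?nnegrE ?expR_ge0//.
by apply: sumr_ge0 => h _; rewrite mulr_ge0// invr_ge0.
Qed.

Lemma Pr_no_collisions d m T (r : seq ({set 'I_d} * 'I_d)) (eps : R) N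
    (E : hashes d m T -> Prop) :
  (0 < m)%N -> expR 2 * N%:R <= eps * m%:R ->
  (forall u, u \in r -> (#|u.1| <= N)%N) ->
  (forall H, (forall u, u \in r ->
     (collisions H u.1 u.2)%:R < eps * T%:R) -> E H) ->
  1 - (size r)%:R * expR (- (eps * T%:R)) <= Pr E :> R.
Proof.
move=> m0 Nm small goodE.
pose B (u : {set 'I_d} * 'I_d) (H : hashes d m T) : bool :=
  eps * T%:R <= (collisions H u.1 u.2)%:R.
apply: le_trans (Pr_union_bound (r := r) (B := B) m0 _); last first.
  by move=> H good; apply: goodE => u /good; rewrite -ltNge.
rewrite lerD2l lerN2 mulr_natl -iter_addr_0 -count_predT -big_const_seq.
rewrite big_seq [leRHS]big_seq.
apply: ler_sum => u ur; apply: Pr_collisions => //.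
by apply: le_trans Nm; rewrite ler_pM2l ?expR_gt0// ler_nat small.
Qed.

(** * Union bound over the pairs of vectors of the family *)

Definition pair_support d (x y : 'rV[R]_d) : {set 'I_d} :=
  [set j | (x 0 j != 0) || (y 0 j != 0)].

Lemma pair_supportC d (x y : 'rV[R]_d) : pair_support x y = pair_support y x.
Proof. by apply/setP => j; rewrite !inE orbC. Qed.

Lemma notin_pair_support d (x y : 'rV[R]_d) k :
  k \notin pair_support x y -> x 0 k = 0.
Proof. by rewrite inE negb_or negbK => /andP[/eqP]. Qed.

Lemma card_pair_support d s (x y : 'rV[R]_d) :
  sparse s x -> sparse s y -> (#|pair_support x y| <= 2 * s)%N.
Proof.
move=> xs ys; rewrite mul2n -addnn; apply: leq_trans (leq_add xs ys).
rewrite -[X in (_ <= X + _)%N]cardsE -[X in (_ <= _ + X)%N]cardsE.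
apply: leq_trans (leq_card_setU _ _).1; apply: subset_leq_card.
by apply/subsetP => j; rewrite !inE.
Qed.

(** [J x y] lists the coordinates to protect for the pair: the whole joint support for l_p, a single
    maximising coordinate for l_oo. *)
Lemma Pr_no_collisions_family d n s m T (X : {fset 'rV[R]_d})
    (J : 'rV[R]_d -> 'rV[R]_d -> seq 'I_d) K (eps : R)
    (E : hashes d m T -> Prop) :
  sparse_family n s X -> (0 < m)%N ->
  expR 2 * (2 * s)%:R <= eps * m%:R ->
  (forall x y, x \in X -> y \in X -> (size (J x y) <= K)%N) ->
  (forall H, (forall x y j, x \in X -> y \in X -> j \in J x y ->
     (collisions H (pair_support x y) j)%:R < eps * T%:R) -> E H) ->
  1 - (n * n * K)%:R * expR (- (eps * T%:R)) <= Pr E :> R.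
Proof.
move=> [nX sX] m0 sm JK goodE.
pose XX := [seq (x, y) | x <- enum_fset X, y <- enum_fset X].
pose r := [seq (pair_support xy.1 xy.2, j) | xy <- XX, j <- J xy.1 xy.2].
have XXX xy : xy \in XX -> xy.1 \in X /\ xy.2 \in X.
  by case/allpairsP => -[x y] /= [xX yX ->].
apply: le_trans (Pr_no_collisions (r := r) m0 sm _ _).
- rewrite lerD2l lerN2 ler_wpM2r ?expR_ge0// ler_nat -nX.
  have <- : size XX = (#|` X| * #|` X|)%N by rewrite size_allpairs.
  rewrite size_allpairs_dep sumnE big_map.
  rewrite mulnC -iter_addn_0 -count_predT -big_const_seq big_seq [X in (_ <= X)%N]big_seq.
  by apply: leq_sum => xy /XXX[xX yX]; exact: JK.
- move=> u /allpairsPdep[xy [j [/XXX[xX yX] _ ->]]] /=.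
  by apply: card_pair_support; [case: (sX _ xX)|case: (sX _ yX)].
- move=> H good; apply: goodE => x y j xX yX jJ.
  apply: (good (pair_support x y, j)).
  by apply/allpairsPdep; exists (x, y), j; rewrite allpairs_f.
Qed.

(** Of the [c + k] powers of [N] gained from the exponential, [k] pay for the [M] events and [c]
    remain. *)
Lemma expR_tail (N M k : nat) (c a : R) :
  (0 < N)%N -> (M <= N ^ k)%N -> (c + k%:R) * ln N%:R <= a ->
  M%:R * expR (- a) <= N%:R `^ (- c).
Proof.
move=> N0 MN ca; have N0' : (N%:R : R) != 0 by rewrite pnatr_eq0 -lt0n.
have -> : N%:R `^ (- c) = N%:R ^+ k * N%:R `^ (- (c + k%:R)).
  rewrite -powR_mulrn// -powRD ?N0' ?implybT//.
  by congr (_ `^ _); lra.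
apply: ler_pM => //; first exact: expR_ge0.
  by rewrite -natrX ler_nat.
by rewrite /powR (negPf N0') ler_expR mulNr lerN2.
Qed.

End Probability.

(** * Choice of constants and assembly *)

Theorem mainTheorem7 (R : realType) :
  (forall c : R, 0 < c ->
     exists C1 C2 : R, [/\ 0 < C1, 0 < C2 &
       forall (eps : R) (d n s m T : nat) (X : {fset 'rV[R]_d}),
         0 < eps < 1 -> sparse_family n s X -> (0 < m)%N ->
         C1 * (s%:R / eps) <= m%:R ->
         C2 * (ln ((n * s)%:R : R) / eps) <= T%:R ->
         1 - n%:R `^ (- c) <=
           Pr (fun H : hashes d m T =>
             forall p : R, 1 <= p ->
             forall x y : 'rV[R]_d, x \in X -> y \in X ->
               (1 - eps) * lpnorm p (x - y) `^ p
                 <= lpnorm p (embed H x - embed H y) `^ p / T%:R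
                 <= (1 + eps) * lpnorm p (x - y) `^ p)])
  /\
  (forall c : R, 0 < c ->
     exists C1 C2 : R, [/\ 0 < C1, 0 < C2 &
       forall (d n s m T : nat) (X : {fset 'rV[R]_d}),
         sparse_family n s X -> (0 < m)%N ->
         C1 * s%:R <= m%:R ->
         C2 * ln (n%:R : R) <= T%:R ->
         1 - n%:R `^ (- c) <=
           Pr (fun H : hashes d m T =>
             forall x y : 'rV[R]_d, x \in X -> y \in X ->
               `|embed H x - embed H y| = `|x - y|)])
  /\
  (forall (d n s : nat) (X : {fset 'rV[R]_d}),
     sparse_family n s X ->
     Pr (fun H : hashes d 1 1 =>
       forall x y : 'rV[R]_d, x \in X -> y \in X ->
         `|x + y| <= `|embed H x + embed H y| <= 2 * `|x + y|) = 1 :> R).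
Proof.
have e2 := expR_gt0 (2 : R).
split; [|split].
(* A joint support has at most [2 * s] elements, and [Pr_collisions] asks for [expR 2] times that.
   The 3 comes from the bound [(n * s) ^ 3] on the number of triples. *)
- move=> c c0; exists (2 * expR 2), (c + 3); split; [lra|lra|].
  move=> eps d n s m T X /andP[eps0 eps1] sX m0 sm nT.
  (* For [n = 1] the claimed bound is 0. Otherwise a positive [n * s] is at least 2, which absorbs
     the factor 2 in the number of triples. *)
  have [->|n1] := eqVneq n 1%N; first by rewrite powR1 subrr Pr_ge0.
  have sm' : expR 2 * (2 * s)%:R <= eps * m%:R.
    rewrite -ler_pdivrMl// natrM; apply: le_trans sm.
    by rewrite le_eqVlt; apply/orP; left; apply/eqP; ring.
  apply: le_trans (Pr_no_collisions_family (K := 2 * s)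
    (J := fun x y => enum (pair_support x y)) sX m0 sm' _ _).
  + rewrite lerD2l lerN2.
    rewrite mulnACA; have [->|ns0] := posnP (n * s)%N.
      by rewrite muln0 mul0r powR_ge0.
    have [n0 s0] : (0 < n)%N /\ (0 < s)%N by apply/andP; rewrite -muln_gt0.
    have n2 : (1 < n)%N by rewrite ltn_neqAle eq_sym n1.
    apply: le_trans (expR_tail (N := n * s) (k := 3) (c := c) ns0 _ _) _.
    * rewrite expnSr leq_mul2r; apply/orP; right; rewrite -mulnn.
      by rewrite leq_mul ?leq_pmulr// (leq_trans n2) ?leq_pmulr.
    * by move: nT; rewrite mulrA ler_pdivrMr// [T%:R * _]mulrC.
    (* The tail bound is a power of [n * s]; since [n <= n * s], it is at most the same negative
       power of [n]. *)
    rewrite !powRN lef_pV2 ?posrE ?powR_gt0 ?ltr0n//.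
    by rewrite (ge0_ler_powR (ltW c0)) ?nnegrE// ler_nat leq_pmulr.
  + move=> x y xX yX; rewrite -cardE.
    by apply: card_pair_support; [case: (sX.2 _ xX)|case: (sX.2 _ yX)].
  + move=> H good p p1 x y xX yX.
    have p0 : 0 < p by lra.
    have [[x0 _] [y0 _]] := (sX.2 _ xX, sX.2 _ yX).
    have xS := @notin_pair_support _ _ x y.
    have yS := @notin_pair_support _ _ y x; rewrite pair_supportC in yS.
    have few j : j \in pair_support x y ->
        (collisions H (pair_support x y) j)%:R < eps * T%:R.
      by move=> jS; apply: good; rewrite // mem_enum.
    set L := lpnorm p (x - y) `^ p.
    have L0 : 0 <= L by exact: powR_ge0.
    (* With no copies, [few] asks for a negative number of collisions, so the joint support is
       empty, [L = 0] and all three sides vanish. *)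
    have [T0|T0] := posnP T.
      have T0R : T%:R = 0 :> R by rewrite T0.
      suff -> : L = 0 by rewrite T0R invr0 !mulr0 lexx.
      rewrite /L lpnorm_powR ?lt0r_neq0// big1// => j _.
      have [/few|jS] := boolP (j \in pair_support x y).
        by rewrite T0R mulr0 ltNge ler0n.
      by rewrite !mxE xS// yS// subrr normr0 powR0// lt0r_neq0.
    have T0' : (0 : R) < T%:R by rewrite ltr0n.
    rewrite ler_pdivlMr// ler_pdivrMr//; apply/andP; split.
      rewrite mulrAC; apply: embed_lp_ge xS yS _ => //.
        exact: lt0r_neq0.
      by move=> j /few/ltW.
    apply: le_trans (embed_lp_le H p0 x0 y0) _.
    rewrite mulrC ler_wpM2r// ler_peMl//; lra.
(* Same constant for [m], now with [eps = 1]; one coordinate for each of [n * n] pairs costs two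
   powers of [n]. *)
- move=> c c0; exists (2 * expR 2), (c + 2); split; [lra|lra|].
  move=> d n s m T X sX m0 sm nT.
  have sm' : expR 2 * (2 * s)%:R <= 1 * m%:R :> R by rewrite natrM; lra.
  apply: le_trans (Pr_no_collisions_family (K := 1)
    (J := fun x y => seq_of_opt [pick j | `|x - y| == `|(x - y) 0 j|])
    sX m0 sm' _ _).
  + rewrite lerD2l lerN2 muln1 mul1r.
    have [->|n0] := posnP n; first by rewrite mul0r powR_ge0.
    exact: (expR_tail (k := 2)).
  + by move=> x y xX yX; case: pickP.
  + move=> H good x y xX yX.
    have [[x0 _] [y0 _]] := (sX.2 _ xX, sX.2 _ yX).
    apply/le_anti; rewrite embed_sup_le//=.
    have [->|xy] := eqVneq x y; first by rewrite !subrr !normr0.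
    have [j0 ej0] : exists j, `|x - y| = `|(x - y) 0 j|.
      by apply: rV_norm_attained; rewrite subr_eq0.
    (* The witness [j0] shows that [pick] succeeds; the coordinate it returns may differ from
       [j0]. *)
    have := good x y ^~ xX ^~ yX.
    case: pickP => [j /eqP ej|/(_ j0)]; last by rewrite ej0 eqxx.
    move=> /(_ j); rewrite mem_seq1 eqxx => /(_ isT).
    rewrite mul1r ltr_nat => few.
    (* Fewer than [T] copies collide at [j], so some copy isolates it. *)
    have /existsP[t iso] : [exists t, isolated (H t) (pair_support x y) j].
      apply: contraLR few; rewrite negb_exists => /forallP none.
      rewrite -leqNgt -[X in (X <= _)%N](card_ord T) subset_leq_card//.
      by apply/subsetP => t _; rewrite inE none.
    rewrite ej; apply: embed_sup_ge iso => //.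
      by move=> k; exact: notin_pair_support.
    by move=> k; rewrite pair_supportC; exact: notin_pair_support.
- move=> d n s X sX; apply: Pr_sure => // H x y xX yX.
  by apply: embed1_sup; [case: (sX.2 _ xX)|case: (sX.2 _ yX)].
Qed.
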